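(* Let $p,q,m$ be non-negative integers and let $G_{q+m}$ and $H_{p+m}$ be two abelian groups of orders $q+m$ and $p+m$, respectively. Let $\mathcal R$ (resp. $\tilde{\mathcal R}$) be the regular representation of $G_{q+m}$ (resp. $H_{p+m}$) over $\mathbb C$. If $\gcd(p,q,m)=1$, then $$\dim\big(\mathcal S^p(\mathcal R)\otimes\wedge^m(\mathcal R)\big)_{G_{q+m}}=\dim\big(\mathcal S^q(\tilde{\mathcal R})\otimes\wedge^m(\tilde{\mathcal R})\big)_{H_{p+m}}.$$ Indeed, both dimensions are equal to $\frac{1}{p+q+m}\binom{p+q+m}{p,q,m}$.
   Context: For a finite group $G$ and a finite-dimensional representation $V$ of $G$ over $\mathbb C$, $\mathcal S^p(V)$ is the $p$-th symmetric power of $V$ and $\wedge^m(V)$ the $m$-th exterior power, each with the induced action of $G$, and $\mathcal S^p(V)\otimes\wedge^m(V)$ carries the diagonal $G$-action. The notation $\big(\mathcal S^p(V)\otimes\wedge^m(V)\big)_{G}$ denotes the isotypic component of $\mathcal S^p(V)\otimes\wedge^m(V)$ corresponding to the trivial representation of $G$ (i.e. the subspace of $G$-invariants). The orders $q+m$ and $p+m$ are positive, being orders of groups. The multinomial coefficient is $\binom{p+q+m}{p,q,m}=\frac{(p+q+m)!}{p!\,q!\,m!}$. *)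

(* Defs.v *)
From HB Require Import structures.
From mathcomp Require Import all_boot all_order all_algebra.
From mathcomp Require Import all_fingroup all_solvable all_field all_character.
From mathcomp Require Import complex reals.

Set Implicit Arguments.
Unset Strict Implicit.
Unset Printing Implicit Defensive.

Import Order.TTheory GRing.Theory Num.Theory.

Local Open Scope ring_scope.

(* Representations are those of mxrepresentation: matrices acting on row      *)
(* vectors from the right.                                                    *)

Section TensorPower.

Variables (F : numFieldType) (n p : nat).

(* The standard basis of the p-th tensor power of F^n is indexed by the maps  *)
(* 'I_p -> 'I_n, enumerated by enum_val.                                      *)
Definition tpow_dim : nat := #|{ffun 'I_p -> 'I_n}|.

(* v_1 (x) ... (x) v_p, where v_k is the k-th row of v. *)
Definition ptensor (v : 'M[F]_(p, n)) : 'rV[F]_tpow_dim :=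
  \row_j \prod_(k < p) v k ((enum_val j : {ffun 'I_p -> 'I_n}) k).

Definition tpow_mx (A : 'M[F]_n) : 'M[F]_tpow_dim :=
  \matrix_(i, j) \prod_(k < p) A ((enum_val i : {ffun 'I_p -> 'I_n}) k)
                                 ((enum_val j : {ffun 'I_p -> 'I_n}) k).

(* The place permutation v_1 (x) ... (x) v_p |-> v_(s 1) (x) ... (x) v_(s p). *)
Definition place_perm_mx (s : 'S_p) : 'M[F]_tpow_dim :=
  \matrix_(i, j) ((enum_val i : {ffun 'I_p -> 'I_n}) ==
     [ffun k => (enum_val j : {ffun 'I_p -> 'I_n}) ((s^-1)%g k)])%:R.

(* The p-th symmetric and exterior powers are the quotients of the tensor     *)
(* power by the row spaces of sym_rel and ext_rel, i.e. by all s.t - t and    *)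
(* all sgn(s) s.t - t respectively. By ext_relP the latter is, as 2 is        *)
(* invertible, the span of the v_1 (x) ... (x) v_p with v_i = v_j, i <> j.    *)
Definition sym_rel : 'M[F]_tpow_dim :=
  (\sum_(s : 'S_p) (place_perm_mx s - 1%:M)%R)%MS.

Definition ext_rel : 'M[F]_tpow_dim :=
  (\sum_(s : 'S_p) ((-1) ^+ s *: place_perm_mx s - 1%:M)%R)%MS.

Lemma big_tpow (f : {ffun 'I_p -> 'I_n} -> F) :
  \sum_(j < tpow_dim) f (enum_val j) = \sum_g f g.
Proof.
rewrite [RHS](reindex (fun j : 'I_tpow_dim => enum_val j)) //=.
by exists enum_rank => x _; rewrite ?enum_valK ?enum_rankK.
Qed.

Lemma ptensor_tpow_mx v A : ptensor v *m tpow_mx A = ptensor (v *m A).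
Proof.
apply/rowP => j; rewrite !mxE.
transitivity (\sum_(g : {ffun 'I_p -> 'I_n}) \prod_(k < p) (v k (g k)
    * A (g k) ((enum_val j : {ffun 'I_p -> 'I_n}) k))).
  rewrite -big_tpow; apply: eq_bigr => i _.
  by rewrite !mxE -big_split.
pose B k l := v k l * A l ((enum_val j : {ffun 'I_p -> 'I_n}) k).
transitivity (\prod_k \sum_l B k l); first by rewrite bigA_distr_bigA.
by apply: eq_bigr => k _; rewrite mxE.
Qed.

Lemma ptensor_place_perm v s :
  ptensor v *m place_perm_mx s = ptensor (row_perm s v).
Proof.
apply/rowP => j; rewrite !mxE.
pose h : {ffun 'I_p -> 'I_n} :=
  [ffun k => (enum_val j : {ffun 'I_p -> 'I_n}) ((s^-1)%g k)].
rewrite (bigD1 (enum_rank h)) //= big1 ?addr0; last first.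
  move=> i neq; rewrite !mxE -/h; case: eqP => [e | _]; last by rewrite mulr0.
  by rewrite -e enum_valK eqxx in neq.
rewrite !mxE -/h enum_rankK eqxx mulr1 [LHS](reindex_inj (@perm_inj _ s)) /=.
by apply: eq_bigr => k _; rewrite !mxE /h ffunE permK.
Qed.

Lemma delta_ptensor (i : 'I_tpow_dim) :
  delta_mx 0 i = ptensor (\matrix_(k < p)
    delta_mx 0 ((enum_val i : {ffun 'I_p -> 'I_n}) k)).
Proof.
apply/rowP => j; rewrite !mxE /=.
have [-> | neq] := eqVneq j i.
  by rewrite big1 // => k _; rewrite !mxE !eqxx.
apply/esym/eqP/prodf_eq0.
have /existsP [k nk] : [exists k : 'I_p,
   (enum_val j : {ffun 'I_p -> 'I_n}) k != (enum_val i : {ffun _ -> _}) k].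
  apply: contraNT neq => /existsPn e; apply/eqP/enum_val_inj/ffunP => k.
  by have := e k; rewrite negbK => /eqP.
by exists k => //; rewrite !mxE (negPf nk).
Qed.

Lemma sub_ptensor (A W : 'M[F]_tpow_dim) :
  (forall v, ptensor v *m A <= W)%MS -> (A <= W)%MS.
Proof.
by move=> AW; apply/row_subP => i; rewrite rowE delta_ptensor.
Qed.

Lemma tpow_mx_eq (A B : 'M[F]_tpow_dim) :
  (forall v, ptensor v *m A = ptensor v *m B) -> A = B.
Proof.
by move=> AB; apply/row_matrixP => i; rewrite !rowE delta_ptensor.
Qed.

Lemma tpow_mxM A B : tpow_mx (A *m B) = tpow_mx A *m tpow_mx B.
Proof. by apply: tpow_mx_eq => v; rewrite mulmxA !ptensor_tpow_mx mulmxA. Qed.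

Lemma tpow_mx1 : tpow_mx 1%:M = 1%:M.
Proof. by apply: tpow_mx_eq => v; rewrite ptensor_tpow_mx !mulmx1. Qed.

Lemma place_perm_tpow s A :
  place_perm_mx s *m tpow_mx A = tpow_mx A *m place_perm_mx s.
Proof.
apply: tpow_mx_eq => v.
rewrite !mulmxA ptensor_place_perm !ptensor_tpow_mx ptensor_place_perm.
by congr ptensor; apply/matrixP => i j; rewrite !mxE;
   apply: eq_bigr => k _; rewrite mxE.
Qed.

Lemma sym_rel_stable A : (sym_rel *m tpow_mx A <= sym_rel)%MS.
Proof.
rewrite /sym_rel sumsmxMr; apply/sumsmx_subP => s _; apply: (sumsmx_sup s) => //.
by rewrite mulmxBl place_perm_tpow mul1mx -[X in _ - X]mulmx1 -mulmxBr submxMl.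
Qed.

Lemma ext_rel_stable A : (ext_rel *m tpow_mx A <= ext_rel)%MS.
Proof.
rewrite /ext_rel sumsmxMr; apply/sumsmx_subP => s _; apply: (sumsmx_sup s) => //.
rewrite mulmxBl -scalemxAl place_perm_tpow mul1mx scalemxAr.
by rewrite -[X in _ - X]mulmx1 -mulmxBr submxMl.
Qed.

Lemma sym_relP (W : 'M[F]_tpow_dim) :
  (sym_rel <= W)%MS <->
  (forall (v : 'M[F]_(p, n)) (s : 'S_p),
     ((ptensor (row_perm s v) - ptensor v)%R <= W)%MS).
Proof.
split=> [/sumsmx_subP sW v s | sW].
  apply: submx_trans (sW s isT).
  by rewrite -ptensor_place_perm -[X in _ - X]mulmx1 -mulmxBr submxMl.
apply/sumsmx_subP => s _; apply: sub_ptensor => v.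
by rewrite mulmxBr mulmx1 ptensor_place_perm.
Qed.

Lemma ptensor_addr (u v w : 'M[F]_(p, n)) (i : 'I_p) :
  row i u = row i v + row i w ->
  (forall k, k != i -> row k v = row k u) ->
  (forall k, k != i -> row k w = row k u) ->
  ptensor u = ptensor v + ptensor w.
Proof.
move=> ui vu wu; apply/rowP => j; rewrite !mxE.
have rE (x y : 'M[F]_(p, n)) k l : row k x = row k y -> x k l = y k l.
  by move/rowP/(_ l); rewrite !mxE.
rewrite (bigD1 i) //= [in RHS](bigD1 i) //= [X in _ = _ + X](bigD1 i) //=.
have -> : u i ((enum_val j : {ffun 'I_p -> 'I_n}) i) =
   v i ((enum_val j : {ffun _ -> _}) i) + w i ((enum_val j : {ffun _ -> _}) i).
  by move/rowP: ui => /(_ ((enum_val j : {ffun _ -> _}) i)); rewrite !mxE.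
by rewrite mulrDl; congr (_ * _ + _ * _); apply: eq_bigr => k ki;
   apply: rE; rewrite ?vu ?wu.
Qed.

Lemma ptensor_swap (W : 'M[F]_tpow_dim) :
  (forall (v : 'M[F]_(p, n)) (i j : 'I_p),
     i != j -> row i v = row j v -> (ptensor v <= W)%MS) ->
  forall v i j, i != j ->
  ((ptensor (row_perm (tperm i j) v) + ptensor v)%R <= W)%MS.
Proof.
move=> altW v i j nij.
pose r a b : 'M[F]_(p, n) :=
  \matrix_k (if k == i then a else if k == j then b else row k v).
have ri a b : row i (r a b) = a by rewrite rowK eqxx.
have rj a b : row j (r a b) = b.
  by rewrite rowK eq_sym (negPf nij) eqxx.
have Dl a a' b : ptensor (r (a + a') b) = ptensor (r a b) + ptensor (r a' b).
  apply: (@ptensor_addr _ _ _ i); first by rewrite !ri.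
    by move=> k ki; rewrite !rowK (negPf ki).
  by move=> k ki; rewrite !rowK (negPf ki).
have Dr a b b' : ptensor (r a (b + b')) = ptensor (r a b) + ptensor (r a b').
  apply: (@ptensor_addr _ _ _ j); first by rewrite !rj.
    by move=> k kj; rewrite !rowK (negPf kj).
  by move=> k kj; rewrite !rowK (negPf kj).
have rW a : (ptensor (r a a) <= W)%MS by apply: (altW _ i j); rewrite // ri rj.
set a := row i v; set b := row j v.
have -> : row_perm (tperm i j) v = r b a.
  apply/row_matrixP => k; rewrite rowK; apply/rowP => l; rewrite !mxE.
  case: tpermP => [-> | -> | /eqP ki /eqP kj].
  - by rewrite eqxx mxE.
  - by rewrite eq_sym (negPf nij) eqxx mxE.
  - by rewrite (negPf ki) (negPf kj) mxE.
have vE : v = r a b.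
  apply/row_matrixP => k; rewrite rowK.
  by case: eqP => [-> // | _]; case: eqP => [-> // | _].
have -> : ptensor v = ptensor (r a b) by rewrite -vE.
have -> : ptensor (r b a) + ptensor (r a b) =
    ptensor (r (a + b) (a + b)) - ptensor (r a a) - ptensor (r b b).
  rewrite Dl !Dr; move: (ptensor _) (ptensor _) (ptensor _) (ptensor _) => x y z t.
  by rewrite [RHS]addrAC (addrA (y + z)) addrK -(addrA y) [y + _]addrC addrK addrC.
by apply: addmx_sub; [apply: addmx_sub => // | ]; rewrite ?eqmx_opp.
Qed.

Lemma ext_relP (W : 'M[F]_tpow_dim) :
  (ext_rel <= W)%MS <->
  (forall (v : 'M[F]_(p, n)) (i j : 'I_p),
     i != j -> row i v = row j v -> (ptensor v <= W)%MS).
Proof.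
split=> [/sumsmx_subP sW v i j nij vij | altW].
  have := submx_trans (submxMl (ptensor v) _) (sW (tperm i j) isT).
  rewrite odd_tperm nij expr1 scaleN1r mulmxBr mulmxN mulmx1 ptensor_place_perm.
  have -> : row_perm (tperm i j) v = v.
    apply/matrixP => k l; rewrite mxE; move/rowP/(_ l): vij; rewrite !mxE.
    by case: tpermP => [-> | -> |].
  rewrite -opprD eqmx_opp -mulr2n -scaler_nat => vW.
  have := scalemx_sub 2%:R^-1 vW.
  by rewrite scalerA mulVf ?scale1r // pnatr_eq0.
apply/sumsmx_subP => s _; apply: sub_ptensor => v.
rewrite mulmxBr mulmx1 -scalemxAr ptensor_place_perm.
have [ts -> dts] := prod_tpermP s.
elim: ts dts v => [_|[i j] ts IH /= /andP[nij /IH{}IH]] v.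
  by rewrite big_nil odd_perm1 row_perm1 scale1r subrr sub0mx.
rewrite big_cons odd_permM odd_tperm nij signr_addb expr1 mulN1r row_permM.
set t := (\prod_(_ <- _) _)%g; set w := row_perm _ (row_perm t v).
have := ptensor_swap altW (row_perm t v) nij => swW.
have -> : - (-1) ^+ t *: ptensor w - ptensor v =
    - (-1) ^+ t *: (ptensor w + ptensor (row_perm t v))
    + ((-1) ^+ t *: ptensor (row_perm t v) - ptensor v).
  by rewrite scalerDr addrA scaleNr [- _ *: ptensor (row_perm t v)]scaleNr addrNK.
exact: addmx_sub (scalemx_sub _ swW) (IH v).
Qed.

End TensorPower.

Section Powers.

Variables (F : numFieldType) (gT : finGroupType) (G : {group gT}).
Variables (n : nat) (rG : mx_representation F G n) (p : nat).

Lemma tpow_mx_repr : mx_repr G (fun x => tpow_mx p (rG x)).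
Proof.
by split=> [|x y Gx Gy]; rewrite ?repr_mx1 ?tpow_mx1 // repr_mxM // tpow_mxM.
Qed.

Definition tpow_repr := MxRepresentation tpow_mx_repr.

Lemma sym_rel_module : mxmodule tpow_repr (sym_rel F n p).
Proof. by apply/mxmoduleP => x _; apply: sym_rel_stable. Qed.

Lemma ext_rel_module : mxmodule tpow_repr (ext_rel F n p).
Proof. by apply/mxmoduleP => x _; apply: ext_rel_stable. Qed.

Definition sym_repr := factmod_repr sym_rel_module.

Definition ext_repr := factmod_repr ext_rel_module.

End Powers.

(* rfix_mx is the trivial isotypic component; prod_repr carries the diagonal  *)
(* action.                                                                    *)
Definition dim_invariants (F : numFieldType) (gT : finGroupType)
    (G : {group gT}) (n : nat) (rG : mx_representation F G n) (p m : nat) :=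
  \rank (rfix_mx (prod_repr (sym_repr rG p) (ext_repr rG m)) G).

(* Main.v *)
Require Import Defs.
From mathcomp Require Import all_boot all_order all_algebra.
From mathcomp Require Import all_fingroup all_solvable all_field all_character.
From mathcomp Require Import complex reals.
From mathcomp Require Import ring.

(* The dimension of the invariants is the average over x in G of the product  *)
(* of the traces of x on S^p and on /\^m. On the p-th tensor power of the     *)
(* regular representation, symmetrized or antisymmetrized, the trace of x is  *)
(* a sum over pairs of a map h : {1..p} -> G and a permutation s such that    *)
(* h (s k) = h k * x^-1; such a pair forces every cycle length of s to be a   *)
(* multiple of the order of x, so the trace vanishes unless #[x] divides p.   *)
(* As #[x] also divides q + m, an x that contributes satisfies                *)
(* #[x] %| gcd(p, q, m) = 1, so only x = 1 contributes and, with n = q + m,   *)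
(* n dim = 'C(p + n - 1, p) 'C(n, m).                                         *)

Import GRing.Theory Num.Theory.
Local Open Scope ring_scope.

(** Averaging the character ([sum_mxtrace_rfix]) turns the dimension into traces on the two
    quotients, which [mxtrace_factmod] computes back on the tensor power by means of a symmetrizer.
    The vanishing away from the identity is [prod_regular_perm_eq0], resting on the cycle argument
    of [order_dvd_equivariant]. At the identity the traces count multisets and subsets of the basis.
    Dividing by n = q + m leaves (p + q + m - 1)! / (p! q! m!), which is symmetric in p and q; hence
    the two dimensions agree. *)

(** * Traces, invariants and quotient modules *)

Lemma mxtrace_idempotent (F : fieldType) (n : nat) (P : 'M[F]_n) :
  P *m P = P -> \tr P = (\rank P)%:R.
Proof.
move=> PP; have RC1 : row_base P *m col_base P = 1%:M.
  apply: (row_full_inj (col_base_full P)); apply: (row_free_inj (row_base_free P)).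
  by rewrite mulmx1 mulmxA mulmx_base -mulmxA mulmx_base.
by rewrite -{1}(mulmx_base P) mxtrace_mulC RC1 mxtrace1.
Qed.

(** The averaging operator [P] is idempotent with row space the invariants, so its trace is their
    dimension. *)
Lemma sum_mxtrace_rfix (F : numFieldType) (gT : finGroupType) (G : {group gT})
    (n : nat) (rG : mx_representation F G n) :
  \sum_(x in G) \tr (rG x) = (#|G| * \rank (rfix_mx rG G))%:R.
Proof.
have nzG : #|G|%:R != 0 :> F by rewrite pnatr_eq0 -lt0n cardG_gt0.
pose P := #|G|%:R^-1 *: \sum_(x in G) rG x.
have fixP m (W : 'M_(m, n)) : (W <= rfix_mx rG G)%MS -> W *m P = W.
  move/rfix_mxP => fW; rewrite -scalemxAr mulmx_sumr (eq_bigr (fun=> W)) //.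
  by rewrite sumr_const -scaler_nat scalerA mulVf ?scale1r.
have Pfix : (P <= rfix_mx rG G)%MS.
  apply/rfix_mxP => y Gy; rewrite -scalemxAl mulmx_suml; congr (_ *: _).
  rewrite [RHS](reindex_inj (mulIg y)) /=; apply: eq_big => [x | x Gx].
    by rewrite groupMr.
  by rewrite repr_mxM.
have -> : \rank (rfix_mx rG G) = \rank P.
  apply: eqmx_rank; apply/andP; rewrite Pfix -{1}(fixP _ (rfix_mx rG G)) //.
  by rewrite submxMl.
by rewrite natrM -mxtrace_idempotent ?fixP // mxtraceZ mulrA mulfV // mul1r linear_sum.
Qed.

(** The whole space is the sum of [U] and the image of [P]. As [U] is stable, x followed by [P]
    kills [U], and on the image of [P] it is a copy of the quotient action. [P] need not commute
    with the group. *)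
Lemma mxtrace_factmod (F : fieldType) (gT : finGroupType) (G : {group gT})
    (n : nat) (rG : mx_representation F G n) (U P : 'M[F]_n)
    (Umod : mxmodule rG U) (x : gT) :
  U *m P = 0 -> (P - 1%:M <= U)%MS -> x \in G ->
  \tr (factmod_repr Umod x) = \tr (rG x *m P).
Proof.
move=> UP0 PU Gx.
(* v and w are the inclusion and projection of the quotient, so that P and  *)
(* w *m v are two idempotents with the same kernel U.                       *)
set v := val_factmod (U := U) (1%:M : 'M_(\rank (cokermx U))).
set w := in_factmod U (1%:M : 'M_n).
have killP m (W : 'M_(m, n)) : (W <= U)%MS -> W *m P = 0.
  by case/submxP => D ->; rewrite -mulmxA UP0 mulmx0.
have kill m (W : 'M_(m, n)) : (W <= U)%MS -> W *m w = 0.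
  by move=> WU; rewrite -in_factmodE; apply/eqP; rewrite in_factmod_eq0.
have Pw : P *m w = w.
  by apply/eqP; rewrite -subr_eq0 -{2}[w]mul1mx -mulmxBl kill.
have wvU : (w *m v - 1%:M <= U)%MS.
  rewrite -in_factmod_eq0 linearB /= -/w -val_factmodE val_factmodK.
  by rewrite subrr.
have wvXP : w *m v *m rG x *m P = rG x *m P.
  apply/eqP; rewrite -subr_eq0 -!mulmxBl -[X in _ - X]mul1mx -mulmxBl killP //.
  by apply: submx_trans (mxmoduleP Umod x Gx); rewrite submxMr.
transitivity (\tr (v *m rG x *m w)); first by rewrite /= /factmod_mx in_factmodE.
clearbody v w.
by rewrite -Pw mulmxA mxtrace_mulC !mulmxA wvXP.
Qed.

(** * Characters of symmetric and exterior powers via symmetrizers *)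

Section TwistedSymmetrizer.

Variables (F : numFieldType) (n p : nat) (e : 'S_p -> F).
Hypothesis eM : forall s t : 'S_p, e (s * t)%g = e s * e t.

(** One treatment for both powers: [e] is the trivial character for the symmetric power and the sign
    for the exterior one. *)
Definition symmetrizer : 'M[F]_(tpow_dim n p) :=
  p`!%:R^-1 *: \sum_(s : 'S_p) e s *: place_perm_mx F n s.

Definition twisted_rel : 'M[F]_(tpow_dim n p) :=
  (\sum_(s : 'S_p) (e s *: place_perm_mx F n s - 1%:M)%R)%MS.

Lemma place_perm_mxM (s t : 'S_p) :
  place_perm_mx F n s *m place_perm_mx F n t = place_perm_mx F n (t * s)%g.
Proof.
by apply: tpow_mx_eq => v; rewrite mulmxA !ptensor_place_perm row_permM.
Qed.

(** Multiplying the symmetrizer by one twisted permutation only reindexes its sum. *)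
Lemma twisted_rel_symmetrizer : twisted_rel *m symmetrizer = 0.
Proof.
apply/eqP; rewrite -submx0 sumsmxMr; apply/sumsmx_subP => s _.
rewrite submx0 /symmetrizer -scalemxAr mulmxBl mul1mx mulmx_sumr.
rewrite [X in _ - X](reindex_inj (mulIg s)) -sumrB big1 ?scaler0 // => t _.
by rewrite -scalemxAl -scalemxAr place_perm_mxM scalerA eM mulrC subrr.
Qed.

Lemma symmetrizer_sub1 : (symmetrizer - 1%:M <= twisted_rel)%MS.
Proof.
have nzp : p`!%:R != 0 :> F by rewrite pnatr_eq0 -lt0n fact_gt0.
have -> : symmetrizer - 1%:M =
    p`!%:R^-1 *: \sum_(s : 'S_p) (e s *: place_perm_mx F n s - 1%:M).
  rewrite sumrB scalerBr sumr_const card_Sn -scaler_nat scalerA mulVf //.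
  by rewrite scale1r.
apply: scalemx_sub; apply: summx_sub_sums => s _; exact: submx_refl.
Qed.

Lemma mxtrace_tpow_symmetrizer (A : 'M[F]_n) :
  \tr (tpow_mx p A *m symmetrizer) = p`!%:R^-1 * \sum_(f : {ffun 'I_p -> 'I_n})
    \sum_(s : 'S_p) e s * \prod_k A (f (s k)) (f k).
Proof.
rewrite -scalemxAr mxtraceZ mulmx_sumr linear_sum [in RHS]exchange_big /=; congr (_ * _).
apply: eq_bigr => s _; rewrite -scalemxAr mxtraceZ -mulr_sumr; congr (_ * _).
rewrite /mxtrace -big_tpow; apply: eq_bigr => i _; rewrite mxE.
pose f : {ffun 'I_p -> 'I_n} := enum_val i.
(* In column f, the matrix of s has its only nonzero entry at row f o s^-1; the product is then
   reindexed along s. *)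
rewrite (bigD1 (enum_rank [ffun k => f ((s^-1)%g k)])) //= big1 ?addr0.
  rewrite !mxE enum_rankK eqxx mulr1 (reindex_inj (@perm_inj _ s)) /=.
  by apply: eq_bigr => k _; rewrite ffunE permK.
move=> j nj; rewrite !mxE [_ == _]negbTE ?mulr0 //.
by apply: contraNneq nj => fj; rewrite -fj enum_valK.
Qed.

End TwistedSymmetrizer.

Arguments symmetrizer {F} n p e.
Arguments twisted_rel {F} n p e.

Lemma sym_rel_twisted (F : numFieldType) (n p : nat) :
  sym_rel F n p = twisted_rel n p (fun=> 1).
Proof.
by rewrite /twisted_rel; under eq_bigr do rewrite scale1r.
Qed.

Lemma mxtrace_sym_repr (F : numFieldType) (gT : finGroupType) (G : {group gT})
    (n p : nat) (rG : mx_representation F G n) (x : gT) :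
  x \in G ->
  \tr (sym_repr rG p x) = p`!%:R^-1 * \sum_(f : {ffun 'I_p -> 'I_n})
    \sum_(s : 'S_p) \prod_k rG x (f (s k)) (f k).
Proof.
move=> Gx; have eM (s t : 'S_p) : 1 = 1 * 1 :> F by rewrite mulr1.
rewrite (mxtrace_factmod _ _ _ _ _ _ (symmetrizer n p (fun=> 1))) //.
- rewrite mxtrace_tpow_symmetrizer; congr (_ * _).
  by apply: eq_bigr => f _; apply: eq_bigr => s _; rewrite mul1r.
- by rewrite sym_rel_twisted twisted_rel_symmetrizer.
- by rewrite sym_rel_twisted symmetrizer_sub1.
Qed.

Lemma mxtrace_ext_repr (F : numFieldType) (gT : finGroupType) (G : {group gT})
    (n p : nat) (rG : mx_representation F G n) (x : gT) :
  x \in G ->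
  \tr (ext_repr rG p x) = p`!%:R^-1 * \sum_(f : {ffun 'I_p -> 'I_n})
    \sum_(s : 'S_p) (-1) ^+ s * \prod_k rG x (f (s k)) (f k).
Proof.
move=> Gx; have eM (s t : 'S_p) : (-1) ^+ (s * t)%g = (-1) ^+ s * (-1) ^+ t :> F.
  by rewrite odd_permM signr_addb.
pose e (s : 'S_p) : F := (-1) ^+ s.
rewrite (mxtrace_factmod _ _ _ _ _ _ (symmetrizer n p e)) //.
- exact: mxtrace_tpow_symmetrizer.
- exact: twisted_rel_symmetrizer.
- exact: symmetrizer_sub1.
Qed.

(** Going once round a cycle of length N gives h k = h k * x^N, so the order of x divides every
    cycle length, hence their sum. *)
Lemma order_dvd_equivariant (T : finType) (gT : finGroupType) (s : {perm T})
    (h : T -> gT) (x : gT) :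
  (forall k, h (s k) = (h k * x)%g) -> (#[x]%g %| #|T|)%N.
Proof.
move=> hs; have hiter N k : h (iter N s k) = (h k * x ^+ N)%g.
  by elim: N => [|N IHN]; rewrite ?mulg1 //= hs IHN expgSr mulgA.
have part : partition (porbits s) [set: T].
  have -> : porbits s = [set orbit 'P <[s]> k | k in [set: T]].
    by apply/setP => X; apply/imsetP/imsetP => -[k _ ->]; exists k;
      rewrite ?inE ?porbitE.
  apply: orbit_partition.
  by apply/actsP => a _ k; rewrite !inE.
rewrite -cardsT (card_partition part); apply: dvdn_sum => _ /imsetP[k _ ->].
by rewrite order_dvdn -(inj_eq (mulgI (h k))) -hiter iter_porbit mulg1.
Qed.

(** * Traces at the identity: counting multisets and subsets *)

Lemma prod_scalar1_perm (R : comNzRingType) (n p : nat)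
    (f : {ffun 'I_p -> 'I_n}) (s : 'S_p) :
  \prod_k (1%:M : 'M[R]_n) (f (s k)) (f k) = [forall k, f (s k) == f k]%:R.
Proof.
case: (altP forallP) => [fs | /forallPn[k nk]].
  by apply: big1 => k _; rewrite mxE fs.
by rewrite (bigD1 k) //= mxE (negPf nk) mul0r.
Qed.

Lemma sum_stab_sign (F : numFieldType) (n p : nat) (f : {ffun 'I_p -> 'I_n}) :
  \sum_(s : 'S_p) (-1) ^+ s * [forall k, f (s k) == f k]%:R =
    (injectiveb f)%:R :> F.
Proof.
case: (altP (injectiveP f)) => [inj_f | /injectivePn[i [j nij fij]]].
  rewrite (bigD1 1%g) //= odd_perm1 big1 ?addr0 ?mul1r => [|s ns].
    by rewrite (introT forallP) // => k; rewrite perm1.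
  rewrite [_%:R]mulrb ifN ?mulr0 //; apply: contraNN ns => /forallP fs.
  by apply/eqP/permP => k; rewrite perm1; apply/inj_f/eqP.
(* Right multiplication by the transposition of i and j negates the sum. *)
set S := LHS; suff SN : S = - S.
  by apply/eqP; rewrite -[_ == _](mulrn_eq0 S 2) mulr2n {1}SN addNr.
rewrite {1}/S (reindex_inj (mulIg (tperm i j))) -sumrN /=.
apply: eq_bigr => s _; rewrite odd_permM odd_tperm nij addbT signrN mulNr.
congr (- (_ * (nat_of_bool _)%:R)); apply: eq_forallb => k; rewrite permM.
by case: tpermP => [-> | -> | //]; rewrite fij.
Qed.

Section PlaceAction.

Variables (n p : nat).

(** The inverse makes this a right action. Its orbits are the multisets of p values. *)
Definition place_act (f : {ffun 'I_p -> 'I_n}) (s : 'S_p) :=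
  [ffun k => f ((s^-1)%g k)].

Lemma place_act1 : place_act^~ 1%g =1 id.
Proof. by move=> f; apply/ffunP => k; rewrite ffunE invg1 perm1. Qed.

Lemma place_actM f : act_morph place_act f.
Proof. by move=> s t; apply/ffunP => k; rewrite !ffunE invMg permM. Qed.

Canonical place_action := TotalAction place_act1 place_actM.

Lemma mem_place_orbit (f g : {ffun 'I_p -> 'I_n}) :
  (g \in orbit place_action [set: 'S_p] f) =
  perm_eq [tuple g i | i < p] [tuple f i | i < p].
Proof.
apply/imsetP/tuple_permP => [[s _ ->] | [s gs]].
  exists s^-1%g; congr val; apply: eq_from_tnth => k.
  by rewrite !tnth_mktuple ffunE.
exists s^-1%g => //; apply/ffunP => k; rewrite ffunE invgK.
have /(congr1 (fun t => tnth t k)) : [tuple g i | i < p] =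
   [tuple tnth [tuple f i | i < p] (s i) | i < p] by apply: val_inj.
by rewrite !tnth_mktuple.
Qed.

End PlaceAction.

(** Each orbit contains exactly one sorted tuple, obtained by sorting any member. *)
Lemma card_place_orbits (n p : nat) :
  #|[set orbit (place_action n.+1 p) [set: 'S_p] f | f in setT]| = 'C(p + n, p).
Proof.
rewrite -card_sorted_tuples.
set S := [set t | _].
pose ft (t : p.-tuple 'I_n.+1) := [ffun i => tnth t i].
have ftK t : [tuple ft t i | i < p] = t.
  by apply: eq_from_tnth => k; rewrite tnth_mktuple ffunE.
have leqv_trans : transitive (relpre (@nat_of_ord n.+1) leq).
  by move=> x y z; apply: leq_trans.
have leqv_total : total (relpre (@nat_of_ord n.+1) leq).
  by move=> x y; apply: leq_total.
have leqv_anti : antisymmetric (relpre (@nat_of_ord n.+1) leq).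
  by move=> x y /anti_leq /val_inj.
rewrite -(card_in_imset (f := fun t => orbit (place_action n.+1 p) setT (ft t))).
  apply: eq_card => O; apply/imsetP/imsetP => [[f _ ->] | [t _ ->]]; last first.
    by exists (ft t).
  exists (sort_tuple (relpre (@nat_of_ord n.+1) leq) [tuple f i | i < p]).
    by rewrite inE sorted_map sort_sorted.
  by apply/orbit_eqP; rewrite mem_place_orbit ftK perm_sym perm_sort.
move=> t u; rewrite !inE !sorted_map => st su /orbit_eqP.
rewrite mem_place_orbit !ftK => tu.
by apply/val_inj/(sorted_eq leqv_trans leqv_anti).
Qed.

(** Burnside's count: the pairs (f, s) with f fixed by s number p! times the orbits. *)
Lemma sum_card_place_stab (n p : nat) :
  (\sum_(f : {ffun 'I_p -> 'I_n.+1}) \sum_(s : 'S_p)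
     [forall k, f (s k) == f k] = 'C(p + n, p) * p`!)%N.
Proof.
have acts : [acts [set: 'S_p], on setT | place_action n.+1 p].
  by apply/actsP => s _ f; rewrite !inE.
have := Frobenius_Cauchy acts; rewrite card_place_orbits cardsT card_Sn => <-.
rewrite exchange_big [RHS]big_mkcond /=; apply: eq_bigr => s _.
rewrite inE -sum1_card [RHS]big_mkcond /=.
apply: eq_bigr => f _; rewrite in_setI in_setT /=.
case: forallP => [fs | nfs].
  rewrite ifT //; apply/afix1P/ffunP => k.
  by rewrite /= ffunE; have /eqP := fs ((s^-1)%g k); rewrite permKV.
rewrite ifF //; apply/negP => /afix1P sf; apply: nfs => k.
by rewrite -{1}sf /= ffunE permK.
Qed.

(** Positivity of n matters: at n = 0 the truncated [n.-1] would give 1 even for p > 0. *)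
Lemma mxtrace_sym_repr1 (F : numFieldType) (gT : finGroupType) (G : {group gT})
    (n p : nat) (rG : mx_representation F G n) :
  (0 < n)%N -> \tr (sym_repr rG p 1%g) = 'C(p + n.-1, p)%:R.
Proof.
case: n rG => // n rG _; rewrite mxtrace_sym_repr // repr_mx1.
under eq_bigr do under eq_bigr do rewrite prod_scalar1_perm.
under eq_bigr do rewrite -natr_sum.
rewrite -natr_sum sum_card_place_stab natrM mulrC mulfK //.
by rewrite pnatr_eq0 -lt0n fact_gt0.
Qed.

(** By [sum_stab_sign] only injective maps survive, and each subset of size p is the image of p! of
    them. *)
Lemma mxtrace_ext_repr1 (F : numFieldType) (gT : finGroupType) (G : {group gT})
    (n p : nat) (rG : mx_representation F G n) :
  \tr (ext_repr rG p 1%g) = 'C(n, p)%:R.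
Proof.
rewrite mxtrace_ext_repr // repr_mx1.
under eq_bigr do under eq_bigr do rewrite prod_scalar1_perm.
under eq_bigr do rewrite sum_stab_sign.
rewrite -natr_sum -big_mkcond /= sum1_card -cardsE card_inj_ffuns !card_ord.
rewrite -bin_ffact natrM mulrC mulfK //.
by rewrite pnatr_eq0 -lt0n fact_gt0.
Qed.

(** * The regular representation and the dimension formula *)

Lemma prod_regular_perm_eq0 (F : fieldType) (gT : finGroupType) (G : {group gT})
    (p : nat) (x : gT) (f : {ffun 'I_p -> 'I_(gcard G)}) (s : 'S_p) :
  x \in G -> ~~ (#[x]%g %| p)%N ->
  \prod_k regular_repr F G x (f (s k)) (f k) = 0.
Proof.
move=> Gx; apply: contraNeq => nz; rewrite -orderV -[p]card_ord.
(* The matrix of x is a permutation matrix, so a nonzero product forces h (s k) * x = h k for every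
   k; hence x^-1, of the same order, is the translation. *)
apply: (order_dvd_equivariant _ _ s (fun k => enum_val (f k))) => k.
have /prodf_neq0 /(_ k isT) := nz; rewrite !mxE /=.
case: (f k =P _) => [fk _ | _ /eqP //].
by rewrite fk gring_indexK ?mulgK // groupM ?enum_valP.
Qed.

Lemma mxtrace_sym_regular_eq0 (F : numFieldType) (gT : finGroupType)
    (G : {group gT}) (p : nat) (x : gT) :
  x \in G -> ~~ (#[x]%g %| p)%N -> \tr (sym_repr (regular_repr F G) p x) = 0.
Proof.
move=> Gx xp; rewrite mxtrace_sym_repr // big1 ?mulr0 // => f _.
by rewrite big1 // => s _; rewrite prod_regular_perm_eq0.
Qed.

Lemma mxtrace_ext_regular_eq0 (F : numFieldType) (gT : finGroupType)
    (G : {group gT}) (p : nat) (x : gT) :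
  x \in G -> ~~ (#[x]%g %| p)%N -> \tr (ext_repr (regular_repr F G) p x) = 0.
Proof.
move=> Gx xp; rewrite mxtrace_ext_repr // big1 ?mulr0 // => f _.
by rewrite big1 // => s _; rewrite prod_regular_perm_eq0 // mulr0.
Qed.

Lemma dim_invariants_regular (F : numFieldType) (gT : finGroupType)
    (G : {group gT}) (p m : nat) :
  coprime (gcdn p m) #|G| ->
  (#|G| * dim_invariants (regular_repr F G) p m =
     'C(p + #|G|.-1, p) * 'C(#|G|, m))%N.
Proof.
move=> co; apply: (mulrIn (oner_neq0 F)); rewrite -sum_mxtrace_rfix.
rewrite (bigD1 1%g) //= big1 => [|x /andP[Gx nx1]]; rewrite mxtrace_prod.
  by rewrite addr0 mxtrace_sym_repr1 ?cardG_gt0 // mxtrace_ext_repr1 natrM.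
have [xp | xp] := boolP (#[x]%g %| p)%N; last first.
  by rewrite mxtrace_sym_regular_eq0 ?mul0r.
rewrite mxtrace_ext_regular_eq0 ?mulr0 //.
apply: contra nx1 => xm; rewrite -order_eq1 -dvdn1 -(eqP co) !dvdn_gcd xp xm.
by rewrite order_dvdG.
Qed.

Lemma dim_invariants_regularE (F : numFieldType) (gT : finGroupType)
    (G : {group gT}) (p q m : nat) :
  #|G| = (q + m)%N -> gcdn p (gcdn q m) = 1%N ->
  (dim_invariants (regular_repr F G) p m)%:R =
    (p + q + m)%:R^-1 * ((p + q + m)`!%:R / (p`! * q`! * m`!)%:R) :> rat.
Proof.
move=> cardG gcd1; have n_gt0 := cardG_gt0 G.
have co : coprime (gcdn p m) #|G|.
  by rewrite /coprime cardG -gcdnA gcdnDr (gcdnC m) gcd1.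
have dimE : (dim_invariants (regular_repr F G) p m * (p`! * q`! * m`!) =
    (p + #|G|.-1)`!)%N.
  have nfact : #|G|`! = (#|G| * (#|G|.-1)`!)%N by rewrite -{1 2}(prednK n_gt0) factS.
  have binG : ('C(#|G|, m) * (m`! * q`!) = #|G|`!)%N.
    by rewrite -(@bin_fact #|G| m) cardG ?leq_addl // addnK.
  have := @bin_fact (p + #|G|.-1) p (leq_addr _ _); rewrite addKn => binp.
  have := dim_invariants_regular F gT G p m co.
  (* This factor clears the denominators of both binomials; the n! left on both sides is cancelled
     afterwards. *)
  move/(congr1 (fun k => k * (p`! * (#|G|.-1)`! * (m`! * q`!)))%N).
  rewrite [RHS]mulnACA binp binG => e.
  apply/eqP; rewrite -(eqn_pmul2r (fact_gt0 #|G|)) -e {1}nfact; apply/eqP.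
  by rewrite [LHS]mulnACA; ring.
have -> : (p + q + m = (p + #|G|.-1).+1)%N.
  by rewrite -addnS prednK // cardG addnA.
rewrite factS natrM mulrA mulKf ?pnatr_eq0 // -dimE natrM mulfK //.
by rewrite pnatr_eq0 -lt0n !muln_gt0 !fact_gt0.
Qed.

Theorem theorem1p3 (R : realType) (p q m : nat)
    (gT hT : finGroupType) (G : {group gT}) (H : {group hT})
    (abelG : abelian G) (abelH : abelian H)
    (cardG : #|G| = (q + m)%N) (cardH : #|H| = (p + m)%N)
    (gcd_pqm : gcdn p (gcdn q m) = 1%N) :
  let dimG := dim_invariants (regular_repr R[i] G) p m in
  let dimH := dim_invariants (regular_repr R[i] H) q m in
  let d : rat :=
    (p + q + m)%:R^-1 * ((p + q + m)`!%:R / (p`! * q`! * m`!)%:R) in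
  dimG = dimH /\ dimG%:R = d /\ dimH%:R = d.
Proof.
move=> dimG dimH d.
have dG : dimG%:R = d by apply: dim_invariants_regularE.
have dH : dimH%:R = d.
  (* The formula is invariant under exchanging p and q. *)
  rewrite /d (addnC p) (mulnC p`!).
  by apply: dim_invariants_regularE; rewrite // gcdnCA.
by split=> //; apply: (mulrIn (oner_neq0 rat)); rewrite dG.
Qed.
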